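(* Let $H$ be a bialgebra over a field $k$, and let $B$ be a left $H$-module algebra (an algebra in ${}_H\mathcal{M}$) which is also a left $H$-comodule coalgebra (a coalgebra in ${}^H\mathcal{M}$). Let $B\star H$ denote the vector space $B\otimes H$ equipped with the smash product multiplication and unit and the smash coproduct comultiplication and counit. Then $B\star H$ is a bialgebra if and only if all of the following hold: $B$ is a left $H$-module coalgebra (a coalgebra in ${}_H\mathcal{M}$); $B$ is a left $H$-comodule algebra (an algebra in ${}^H\mathcal{M}$); $\varepsilon_B$ is an algebra map; $\delta_B(1_B)=1_B\otimes 1_B$; and the following identities hold for all $a,b\in B$ and $h\in H$: (1) $\delta_B(ab)=\sum a_1\,(a_{2(-1)}\cdot b_1)\otimes a_{2(0)}\,b_2$, (2) $\sum h_1 b_{(-1)}\otimes h_2\cdot b_{(0)}=\sum (h_1\cdot b)_{(-1)}\,h_2\otimes (h_1\cdot b)_{(0)}$. If, in addition (i.e. when these conditions hold), $B$ has an antipode $S_B$ and $H$ is a Hopf algebra with antipode $S_H$, then $B\star H$ is a Hopf algebra with antipode $$S(b\star h)=\sum \bigl(1_B\star S_H(b_{(-1)}h)\bigr)\bigl(S_B(b_{(0)})\star 1_H\bigr)=\sum \bigl(S_H(b_{(-1)}h)\bigr)_1\cdot S_B(b_{(0)})\otimes \bigl(S_H(b_{(-1)}h)\bigr)_2 .$$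
   Context: All vector spaces are over a field $k$; algebras are associative and unital, coalgebras are coassociative and counital. The comultiplication of $H$ is written $\Delta(h)=\sum h_1\otimes h_2$ and that of $B$ is written $\delta_B(b)=\sum b_1\otimes b_2$ (Sweedler notation); counits are $\varepsilon_H,\varepsilon_B$. A left $H$-module structure is written $h\cdot b$. A left $H$-comodule structure $\rho:B\to H\otimes B$ is written $\rho(b)=\sum b_{(-1)}\otimes b_{(0)}$; it is coassociative and counital. Modules and comodules are unital and counital in the usual sense. The symbol $a_{2(-1)}\otimes a_{2(0)}$ means $\rho$ applied to $a_2$. A single vector space $B$ carries simultaneously a $k$-algebra structure, a $k$-coalgebra structure, a left $H$-module structure and a left $H$-comodule structure. With respect to these: - $B$ is a left $H$-module algebra (algebra in ${}_H\mathcal{M}$) if $h\cdot(ab)=\sum (h_1\cdot a)(h_2\cdot b)$ and $h\cdot 1_B=\varepsilon_H(h)1_B$. - $B$ is a left $H$-module coalgebra (coalgebra in ${}_H\mathcal{M}$) if $\delta_B(h\cdot b)=\sum (h_1\cdot b_1)\otimes (h_2\cdot b_2)$ and $\varepsilon_B(h\cdot b)=\varepsilon_H(h)\varepsilon_B(b)$. - $B$ is a left $H$-comodule algebra (algebra in ${}^H\mathcal{M}$) if $\rho(ab)=\sum a_{(-1)}b_{(-1)}\otimes a_{(0)}b_{(0)}$ and $\rho(1_B)=1_H\otimes 1_B$. - $B$ is a left $H$-comodule coalgebra (coalgebra in ${}^H\mathcal{M}$) if $\sum b_{(-1)}\otimes b_{(0)1}\otimes b_{(0)2}=\sum b_{1(-1)}b_{2(-1)}\otimes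 b_{1(0)}\otimes b_{2(0)}$ and $\sum \varepsilon_B(b_{(0)})\,b_{(-1)}=\varepsilon_B(b)1_H$. The smash product on $B\otimes H$ has multiplication $(a\star g)(b\star h)=\sum a(g_1\cdot b)\star g_2h$ and unit $1_B\otimes 1_H$. The smash coproduct on $B\otimes H$ has comultiplication $\Delta(b\star h)=\sum (b_1\star b_{2(-1)}h_1)\otimes (b_{2(0)}\star h_2)$ and counit $\varepsilon(b\star h)=\varepsilon_B(b)\varepsilon_H(h)$. Here $b\star h$ denotes the element $b\otimes h$ of $B\star H$. An antipode of $B$ is a $k$-linear map $S_B:B\to B$ with $\sum S_B(b_1)b_2=\varepsilon_B(b)1_B=\sum b_1S_B(b_2)$ for all $b\in B$; similarly for $S_H$ on $H$ and for $S$ on $B\star H$. *)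

(* Defs.v *)
From HB Require Import structures.
From mathcomp Require Import all_boot all_algebra.
From mathcomp Require Import boolp.

Set Implicit Arguments.
Unset Strict Implicit.
Unset Printing Implicit Defensive.

Import GRing.Theory.
Local Open Scope ring_scope.
Local Open Scope quotient_scope.

Reserved Notation "V \ox W" (at level 40, left associativity).
Reserved Notation "\tsum_ ( v , w <- t ) F"
  (at level 41, v name, w name, t at level 50, F at level 41,
   format "'[' \tsum_ ( v ,  w  <-  t ) '/  '  F ']'").

(* The tensor product of two vector spaces of arbitrary dimension: finite
   formal sums of pairs, modulo the congruence generated by the bilinearity
   relations. The scalars are absorbed in the pairs. *)
Section TensorProduct.
Variables (k : fieldType) (V W : lmodType k).
Implicit Types s t : seq (V * W).

Inductive tens_eq : seq (V * W) -> seq (V * W) -> Prop :=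
| tens_eq_refl s : tens_eq s s
| tens_eq_sym s t : tens_eq s t -> tens_eq t s
| tens_eq_trans s t r : tens_eq s t -> tens_eq t r -> tens_eq s r
| tens_eq_cat s s' t t' :
    tens_eq s s' -> tens_eq t t' -> tens_eq (s ++ t) (s' ++ t')
| tens_eq_catC s t : tens_eq (s ++ t) (t ++ s)
| tens_eq_0l w : tens_eq [:: (0, w)] [::]
| tens_eq_Dl v v' w : tens_eq [:: (v + v', w)] [:: (v, w); (v', w)]
| tens_eq_Dr v w w' : tens_eq [:: (v, w + w')] [:: (v, w); (v, w')]
| tens_eq_Z a v w : tens_eq [:: (a *: v, w)] [:: (v, a *: w)].

Definition tens_eqb : rel (seq (V * W)) := fun s t => `[< tens_eq s t >].

Lemma tens_eqb_refl : reflexive tens_eqb.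
Proof. by move=> s; apply/asboolP; exact: tens_eq_refl. Qed.

Lemma tens_eqb_sym : symmetric tens_eqb.
Proof. by move=> s t; apply/asboolP/asboolP; exact: tens_eq_sym. Qed.

Lemma tens_eqb_trans : transitive tens_eqb.
Proof.
by move=> t s r /asboolP st /asboolP tr; apply/asboolP; exact: tens_eq_trans tr.
Qed.

Canonical tens_equiv :=
  EquivRel tens_eqb tens_eqb_refl tens_eqb_sym tens_eqb_trans.

Definition tensor := {eq_quot tens_equiv}.
HB.instance Definition _ := Choice.on tensor.
HB.instance Definition _ := EqQuotient.on tensor.

Definition pure (v : V) (w : W) : tensor := \pi_tensor [:: (v, w)].

Lemma tens_piP s t : tens_eq s t <-> \pi_tensor s = \pi_tensor t.
Proof.
split=> [st|st]; first by apply/eqquotP; apply/asboolP.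
by have /eqquotP/asboolP := st.
Qed.

Lemma tens_repr s : tens_eq (repr (\pi_tensor s)) s.
Proof. by apply/tens_piP; rewrite reprK. Qed.

Definition scale_seq (a : k) s := [seq (a *: p.1, p.2) | p <- s].

Definition tens_add (x y : tensor) : tensor := \pi_tensor (repr x ++ repr y).
Definition tens_scale (a : k) (x : tensor) : tensor :=
  \pi_tensor (scale_seq a (repr x)).
Definition tens_opp (x : tensor) : tensor := tens_scale (-1) x.
Definition tens_zero : tensor := \pi_tensor [::].

Lemma scale_seq_eq a s t : tens_eq s t -> tens_eq (scale_seq a s) (scale_seq a t).
Proof.
elim=> {s t} [s|s t _|s t r _ + _|s s' t t' _ + _|s t|w|v v' w|v w w'|b v w] /=.
- exact: tens_eq_refl.
- exact: tens_eq_sym.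
- exact: tens_eq_trans.
- by rewrite /scale_seq !map_cat; exact: tens_eq_cat.
- by rewrite /scale_seq !map_cat; exact: tens_eq_catC.
- by rewrite scaler0; exact: tens_eq_0l.
- by rewrite scalerDr; exact: tens_eq_Dl.
- exact: tens_eq_Dr.
- by rewrite scalerA mulrC -scalerA; exact: tens_eq_Z.
Qed.

Lemma tens_add_pi s t : tens_add (\pi_tensor s) (\pi_tensor t) = \pi_tensor (s ++ t).
Proof. by apply/tens_piP; apply: tens_eq_cat; exact: tens_repr. Qed.

Lemma tens_scale_pi a s : tens_scale a (\pi_tensor s) = \pi_tensor (scale_seq a s).
Proof. by apply/tens_piP; apply: scale_seq_eq; exact: tens_repr. Qed.

Lemma tens_piI (P : tensor -> Prop) : (forall s, P (\pi_tensor s)) -> forall x, P x.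
Proof. by move=> Ppi x; rewrite -[x]reprK. Qed.

Lemma scale_seqDl a b s :
  tens_eq (scale_seq (a + b) s) (scale_seq a s ++ scale_seq b s).
Proof.
elim: s => [|[v w] s IHs] /=; first exact: tens_eq_refl.
rewrite scalerDl -cat1s.
apply: tens_eq_trans (tens_eq_cat (tens_eq_Dl _ _ _) IHs) _.
rewrite /= -cat1s -[X in tens_eq _ X]cat1s.
apply: tens_eq_cat (tens_eq_refl _) _.
rewrite -cat1s -[in X in tens_eq _ X]cat1s !catA.
by apply: tens_eq_cat (tens_eq_catC _ _) (tens_eq_refl _).
Qed.

Lemma scale_seq0 s : tens_eq (scale_seq 0 s) [::].
Proof.
elim: s => [|[v w] s IHs] /=; first exact: tens_eq_refl.
by rewrite scale0r; exact: tens_eq_cat (tens_eq_0l _) IHs.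
Qed.

Lemma tens_addA : associative tens_add.
Proof.
elim/tens_piI=> r; elim/tens_piI=> s; elim/tens_piI=> t.
by rewrite !tens_add_pi catA.
Qed.

Lemma tens_addC : commutative tens_add.
Proof.
elim/tens_piI=> r; elim/tens_piI=> s; rewrite !tens_add_pi.
by apply/tens_piP; exact: tens_eq_catC.
Qed.

Lemma tens_add0 : left_id tens_zero tens_add.
Proof. by elim/tens_piI=> r; rewrite tens_add_pi. Qed.

Lemma scale_seq1 s : scale_seq 1 s = s.
Proof. by rewrite -[RHS]map_id; apply: eq_map => -[v w] /=; rewrite scale1r. Qed.

Lemma tens_addN : left_inverse tens_zero tens_opp tens_add.
Proof.
elim/tens_piI=> s; rewrite /tens_opp tens_scale_pi tens_add_pi; apply/tens_piP.
rewrite -[X in _ ++ X]scale_seq1.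
apply: tens_eq_trans (tens_eq_sym (scale_seqDl _ _ _)) _.
by rewrite addNr; exact: scale_seq0.
Qed.

HB.instance Definition _ :=
  GRing.isZmodule.Build tensor tens_addA tens_addC tens_add0 tens_addN.

Lemma tens_scaleA a b x : tens_scale a (tens_scale b x) = tens_scale (a * b) x.
Proof.
elim/tens_piI: x => s; rewrite !tens_scale_pi /scale_seq -map_comp.
by congr (\pi_tensor _); apply: eq_map => -[v w] /=; rewrite scalerA.
Qed.

Lemma tens_scale1 : left_id 1 tens_scale.
Proof. by elim/tens_piI=> s; rewrite tens_scale_pi scale_seq1. Qed.

Lemma tens_scaleDr : right_distributive tens_scale +%R.
Proof.
move=> a; elim/tens_piI=> s; elim/tens_piI=> t.
rewrite [X in tens_scale _ X](tens_add_pi s t) !tens_scale_pi [RHS]tens_add_pi.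
by rewrite /scale_seq map_cat.
Qed.

Lemma tens_scaleDl x : {morph tens_scale^~ x : a b / a + b}.
Proof.
move=> a b; elim/tens_piI: x => s; rewrite !tens_scale_pi.
rewrite [RHS]tens_add_pi; apply/tens_piP; exact: scale_seqDl.
Qed.

HB.instance Definition _ := GRing.Zmodule_isLmodule.Build k tensor
  tens_scaleA tens_scale1 tens_scaleDr tens_scaleDl.

(* The map out of the tensor product induced by f, written
   \tsum_(v, w <- t) f v w; with t := Delta h this is Sweedler's notation.
   It sums f over one representative of t. If f is bilinear, the value does
   not depend on the representative (tsum_pure, tsum_linear). *)
Definition tsum (U : zmodType) (t : tensor) (f : V -> W -> U) : U :=
  \sum_(p <- repr t) f p.1 p.2.

End TensorProduct.

Notation "V \ox W" := (tensor V%type W%type) : type_scope.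
Notation "v \ox w" := (pure v w) : ring_scope.
Notation "\tsum_ ( v , w <- t ) F" := (tsum t (fun v w => F)) : ring_scope.
Notation is_bilinear f := (bilinear_for *:%R *:%R f).

Section TensorTheory.
Variables (k : fieldType) (V W : lmodType k).

Lemma pure_bilinear : is_bilinear (@pure k V W).
Proof.
have pureZ a (v : V) (w : W) : (a *: v) \ox w = a *: (v \ox w).
  by rewrite [RHS](@tens_scale_pi k V W).
have pureZr a (v : V) (w : W) : v \ox (a *: w) = a *: (v \ox w).
  by rewrite -pureZ; apply/tens_piP; apply: tens_eq_sym; exact: tens_eq_Z.
split=> [w a v v'|v a w w'] /=.
- rewrite -pureZ [RHS](@tens_add_pi k V W); apply/tens_piP; exact: tens_eq_Dl.
- rewrite -pureZr [RHS](@tens_add_pi k V W); apply/tens_piP; exact: tens_eq_Dr.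
Qed.

Lemma pi_tensorE (s : seq (V * W)) :
  \pi_(V \ox W) s = \sum_(p <- s) p.1 \ox p.2.
Proof.
elim: s => [|[v w] s IHs]; first by rewrite big_nil.
by rewrite big_cons -IHs [RHS](@tens_add_pi k V W).
Qed.

Lemma tensorE (t : V \ox W) : t = \tsum_(v, w <- t) v \ox w.
Proof. by rewrite -[LHS]reprK pi_tensorE. Qed.

Section Lift.
Variables (U : lmodType k) (f : V -> W -> U).
Hypothesis f_bil : is_bilinear f.

Let fDl v v' w : f (v + v') w = f v w + f v' w.
Proof. by have /= := f_bil.1 w 1 v v'; rewrite !scale1r. Qed.
Let fDr v w w' : f v (w + w') = f v w + f v w'.
Proof. by have /= := f_bil.2 v 1 w w'; rewrite !scale1r. Qed.
Let f0l w : f 0 w = 0.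
Proof. by apply: (addIr (f 0 w)); rewrite -fDl addr0 add0r. Qed.
Let f0r v : f v 0 = 0.
Proof. by apply: (addIr (f v 0)); rewrite -fDr addr0 add0r. Qed.
Let fZl a v w : f (a *: v) w = a *: f v w.
Proof. by have /= := f_bil.1 w a v 0; rewrite !addr0 f0l addr0. Qed.
Let fZr a v w : f v (a *: w) = a *: f v w.
Proof. by have /= := f_bil.2 v a w 0; rewrite !addr0 f0r addr0. Qed.

Lemma tens_eq_sum (s t : seq (V * W)) : tens_eq s t ->
  \sum_(p <- s) f p.1 p.2 = \sum_(p <- t) f p.1 p.2.
Proof.
elim=> {s t} [s|s t _|s t r _ + _|s s' t t' _ + _|s t|w|v v' w|v w w'|b v w] //=.
- by move=> -> ->.
- by rewrite !big_cat /= => -> ->.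
- by rewrite !big_cat /= addrC.
- by rewrite big_seq1 big_nil /= f0l.
- by rewrite !big_cons !big_nil !addr0 /= fDl.
- by rewrite !big_cons !big_nil !addr0 /= fDr.
- by rewrite !big_seq1 /= fZl fZr.
Qed.

Lemma tsum_pi (s : seq (V * W)) :
  tsum (\pi_(V \ox W) s) f = \sum_(p <- s) f p.1 p.2.
Proof. exact: tens_eq_sum (tens_repr s). Qed.

Lemma tsum_pure v w : tsum (v \ox w) f = f v w.
Proof. by rewrite tsum_pi big_seq1. Qed.

Lemma tsum_linear : linear (fun t => tsum t f).
Proof.
move=> a; elim/tens_piI=> s; elim/tens_piI=> t.
rewrite [X in tsum (X + _) _](@tens_scale_pi k V W).
rewrite [X in tsum X _](@tens_add_pi k V W) !tsum_pi big_cat big_map /=.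
by rewrite scaler_sumr; congr (_ + _); apply: eq_bigr => p _; rewrite fZl.
Qed.

End Lift.

Lemma tensor_ext (U : lmodType k) (f g : V \ox W -> U) :
  linear f -> linear g -> (forall v w, f (v \ox w) = g (v \ox w)) -> f =1 g.
Proof.
move=> f_lin g_lin fg; elim/tens_piI=> s; rewrite pi_tensorE.
have lin0 (h : V \ox W -> U) : linear h -> h 0 = 0.
  by move=> hl; apply: (addIr (h 0)); have := hl 1 0 0; rewrite !scale1r addr0 add0r.
have linD (h : V \ox W -> U) : linear h -> {morph h : x y / x + y}.
  by move=> hl x y; have := hl 1 x y; rewrite !scale1r.
elim: s => [|p s IHs]; first by rewrite big_nil !lin0.
by rewrite big_cons !linD // fg IHs.
Qed.

Lemma tsum_linear_arg (X U : lmodType k) (t : V \ox W) (f : X -> V -> W -> U) :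
  (forall v w, linear (fun x => f x v w)) ->
  linear (fun x => \tsum_(v, w <- t) f x v w).
Proof.
move=> f_lin a x y; rewrite /tsum scaler_sumr -big_split /=.
by apply: eq_bigr => p _; exact: f_lin.
Qed.

End TensorTheory.

Section Structures.
Variable k : fieldType.

Section OneSpace.
Variable V : lmodType k.
Variables (mul : V -> V -> V) (one : V).
Variables (comul : V -> V \ox V) (counit : V -> k).

(* algType k would exclude the zero algebra. *)
Record is_algebra : Prop := IsAlgebra {
  alg_bilinear : is_bilinear mul;
  alg_mulA : forall x y z, mul x (mul y z) = mul (mul x y) z;
  alg_1mul : forall x, mul one x = x;
  alg_mul1 : forall x, mul x one = x
}.

(* Both sides of coassociativity are taken in V \ox (V \ox V). *)
Record is_coalgebra : Prop := IsCoalgebra {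
  coalg_comul_linear : linear comul;
  coalg_counit_linear : scalar counit;
  coalg_coassoc : forall x,
    \tsum_(x1, x2 <- comul x) \tsum_(x11, x12 <- comul x1) x11 \ox (x12 \ox x2)
    = \tsum_(x1, x2 <- comul x) x1 \ox comul x2;
  coalg_counitl : forall x, \tsum_(x1, x2 <- comul x) counit x1 *: x2 = x;
  coalg_counitr : forall x, \tsum_(x1, x2 <- comul x) counit x2 *: x1 = x
}.

Record is_algebra_map (V' : lmodType k) (mul' : V' -> V' -> V') (one' : V')
    (f : V -> V') : Prop := IsAlgebraMap {
  algmap_linear : linear f;
  algmap_mul : forall x y, f (mul x y) = mul' (f x) (f y);
  algmap_one : f one = one'
}.

Definition tensor_mul (s t : V \ox V) : V \ox V :=
  \tsum_(x1, x2 <- s) \tsum_(y1, y2 <- t) mul x1 y1 \ox mul x2 y2.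

Definition is_counit_algebra_map : Prop :=
  @is_algebra_map k^o *%R 1 counit.

Record is_bialgebra : Prop := IsBialgebra {
  bialg_alg : is_algebra;
  bialg_coalg : is_coalgebra;
  bialg_comul : is_algebra_map tensor_mul (one \ox one) comul;
  bialg_counit : is_counit_algebra_map
}.

Record is_antipode (S : V -> V) : Prop := IsAntipode {
  antipode_linear : linear S;
  antipodel : forall x,
    \tsum_(x1, x2 <- comul x) mul (S x1) x2 = counit x *: one;
  antipoder : forall x,
    \tsum_(x1, x2 <- comul x) mul x1 (S x2) = counit x *: one
}.

Definition is_hopf_algebra (S : V -> V) : Prop := is_bialgebra /\ is_antipode S.

End OneSpace.

(* Sweedler components of a coaction are written b' for b_(-1) and b0 for b_(0);
   thus a2' and a20 stand for a_(2(-1)) and a_(2(0)). *)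
Section TwoSpaces.
Variables H B : lmodType k.
Variables (mulH : H -> H -> H) (oneH : H).
Variables (comulH : H -> H \ox H) (counitH : H -> k).
Variables (mulB : B -> B -> B) (oneB : B).
Variables (comulB : B -> B \ox B) (counitB : B -> k).
Variables (act : H -> B -> B) (coact : B -> H \ox B).

Record is_module : Prop := IsModule {
  mod_bilinear : is_bilinear act;
  mod_mul : forall g h b, act (mulH g h) b = act g (act h b);
  mod_one : forall b, act oneH b = b
}.

Record is_comodule : Prop := IsComodule {
  comod_linear : linear coact;
  comod_coassoc : forall b,
    \tsum_(b', b0 <- coact b) \tsum_(h1, h2 <- comulH b') h1 \ox (h2 \ox b0)
    = \tsum_(b', b0 <- coact b) b' \ox coact b0;
  comod_counit : forall b, \tsum_(b', b0 <- coact b) counitH b' *: b0 = b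
}.

Record is_module_algebra : Prop := IsModuleAlgebra {
  modalg_alg : is_algebra mulB oneB;
  modalg_mod : is_module;
  modalg_mul : forall h a b,
    act h (mulB a b) = \tsum_(h1, h2 <- comulH h) mulB (act h1 a) (act h2 b);
  modalg_one : forall h, act h oneB = counitH h *: oneB
}.

Record is_module_coalgebra : Prop := IsModuleCoalgebra {
  modcoalg_coalg : is_coalgebra comulB counitB;
  modcoalg_mod : is_module;
  modcoalg_comul : forall h b,
    comulB (act h b) = \tsum_(h1, h2 <- comulH h) \tsum_(b1, b2 <- comulB b)
      act h1 b1 \ox act h2 b2;
  modcoalg_counit : forall h b, counitB (act h b) = counitH h * counitB b
}.

Record is_comodule_algebra : Prop := IsComoduleAlgebra {
  comodalg_alg : is_algebra mulB oneB;
  comodalg_comod : is_comodule;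
  comodalg_mul : forall a b,
    coact (mulB a b) = \tsum_(a', a0 <- coact a) \tsum_(b', b0 <- coact b)
      mulH a' b' \ox mulB a0 b0;
  comodalg_one : coact oneB = oneH \ox oneB
}.

Record is_comodule_coalgebra : Prop := IsComoduleCoalgebra {
  comodcoalg_coalg : is_coalgebra comulB counitB;
  comodcoalg_comod : is_comodule;
  comodcoalg_comul : forall b,
    \tsum_(b', b0 <- coact b) b' \ox comulB b0
    = \tsum_(b1, b2 <- comulB b)
        \tsum_(b1', b10 <- coact b1) \tsum_(b2', b20 <- coact b2)
          mulH b1' b2' \ox (b10 \ox b20);
  comodcoalg_counit : forall b,
    \tsum_(b', b0 <- coact b) counitB b0 *: b' = counitB b *: oneH
}.

Definition smash_mul (x y : B \ox H) : B \ox H :=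
  \tsum_(a, g <- x) \tsum_(b, h <- y) \tsum_(g1, g2 <- comulH g)
    mulB a (act g1 b) \ox mulH g2 h.

Definition smash_one : B \ox H := oneB \ox oneH.

Definition smash_comul (x : B \ox H) : (B \ox H) \ox (B \ox H) :=
  \tsum_(b, h <- x) \tsum_(b1, b2 <- comulB b) \tsum_(h1, h2 <- comulH h)
    \tsum_(b2', b20 <- coact b2) (b1 \ox mulH b2' h1) \ox (b20 \ox h2).

Definition smash_counit (x : B \ox H) : k :=
  \tsum_(b, h <- x) (counitB b * counitH h).

Section PureTensors.
Hypotheses (mulH_bil : is_bilinear mulH) (mulB_bil : is_bilinear mulB).
Hypotheses (act_bil : is_bilinear act) (coact_lin : linear coact).
Hypotheses (comulH_lin : linear comulH) (comulB_lin : linear comulB).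
Hypotheses (counitH_lin : scalar counitH) (counitB_lin : scalar counitB).

Lemma smash_mul_pure a b g h :
  smash_mul (a \ox g) (b \ox h)
  = \tsum_(g1, g2 <- comulH g) mulB a (act g1 b) \ox mulH g2 h.
Proof.
pose F (a b : B) (h : H) (g1 g2 : H) := mulB a (act g1 b) \ox mulH g2 h.
have F_bil a' b' h' : is_bilinear (F a' b' h').
  split=> [g2 c x y|g1 c x y] /=; rewrite /F.
    by rewrite act_bil.1 mulB_bil.2 (pure_bilinear _ _).1.
  by rewrite mulH_bil.1 (pure_bilinear _ _).2.
rewrite /smash_mul tsum_pure; first rewrite tsum_pure //.
- split=> [h'|b']; apply: tsum_linear_arg => g1 g2 d u v.
    by rewrite act_bil.2 mulB_bil.2 (pure_bilinear _ _).1.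
  by rewrite mulH_bil.2 (pure_bilinear _ _).2.
- split=> [g'|a']; apply: tsum_linear_arg => b' h'.
    apply: tsum_linear_arg => g1 g2 c x y.
    by rewrite mulB_bil.1 (pure_bilinear _ _).1.
  by move=> c x y; rewrite comulH_lin (tsum_linear (F_bil a' b' h')).
Qed.

Lemma smash_comul_pure b h :
  smash_comul (b \ox h)
  = \tsum_(b1, b2 <- comulB b) \tsum_(h1, h2 <- comulH h)
      \tsum_(b2', b20 <- coact b2) (b1 \ox mulH b2' h1) \ox (b20 \ox h2).
Proof.
pose F (b1 : B) (h1 h2 b2' : H) (b20 : B) := (b1 \ox mulH b2' h1) \ox (b20 \ox h2).
have F_bil b1 h1 h2 : is_bilinear (F b1 h1 h2).
  split=> [b20 c x y|b2' c x y] /=; rewrite /F.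
    by rewrite mulH_bil.1 (pure_bilinear _ _).2 (pure_bilinear _ _).1.
  by rewrite (pure_bilinear _ _).1 (pure_bilinear _ _).2.
pose G (b1 b2 : B) (h1 h2 : H) := tsum (coact b2) (F b1 h1 h2).
have G_bil b1 b2 : is_bilinear (G b1 b2).
  split=> [h2|h1]; apply: tsum_linear_arg => b2' b20 c x y; rewrite /F.
    by rewrite mulH_bil.2 (pure_bilinear _ _).2 (pure_bilinear _ _).1.
  by rewrite !(pure_bilinear _ _).2.
rewrite /smash_comul tsum_pure //.
split=> [h' c x y|b']; last first.
  apply: tsum_linear_arg => b1 b2 c x y.
  by rewrite comulH_lin (tsum_linear (G_bil b1 b2)).
pose K (b1 b2 : B) := tsum (comulH h') (G b1 b2).
have K_bil : is_bilinear K.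
  split=> [b2|b1]; apply: tsum_linear_arg => h1 h2.
    apply: tsum_linear_arg => b2' b20 d u v.
    by rewrite /F !(pure_bilinear _ _).1.
  by move=> d u v; rewrite /G coact_lin (tsum_linear (F_bil b1 h1 h2)).
by rewrite comulB_lin (tsum_linear K_bil).
Qed.

Lemma smash_counit_pure b h :
  smash_counit (b \ox h) = counitB b * counitH h.
Proof.
apply: (@tsum_pure k B H k^o).
split=> [h' c x y|b' c x y] /=.
  by rewrite counitB_lin mulrDl -mulrA.
by rewrite counitH_lin mulrDr mulrCA.
Qed.

End PureTensors.

Record biproduct_conditions : Prop := BiproductConditions {
  bipc_module_coalgebra : is_module_coalgebra;
  bipc_comodule_algebra : is_comodule_algebra;
  bipc_counit : is_counit_algebra_map mulB oneB counitB;
  bipc_comul_one : comulB oneB = oneB \ox oneB;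
  bipc_comul_mul : forall a b,
    comulB (mulB a b) =
      \tsum_(a1, a2 <- comulB a) \tsum_(a2', a20 <- coact a2)
        \tsum_(b1, b2 <- comulB b) mulB a1 (act a2' b1) \ox mulB a20 b2;
  bipc_yetter_drinfeld : forall h b,
    \tsum_(h1, h2 <- comulH h) \tsum_(b', b0 <- coact b)
      mulH h1 b' \ox act h2 b0
    = \tsum_(h1, h2 <- comulH h) \tsum_(c', c0 <- coact (act h1 b))
      mulH c' h2 \ox c0
}.

End TwoSpaces.
End Structures.

(* Main.v *)
Require Import Defs.
From mathcomp Require Import all_boot all_algebra ring.

Set Implicit Arguments.
Unset Strict Implicit.
Unset Printing Implicit Defensive.

Import GRing.Theory.
Local Open Scope ring_scope.

(** The biproduct (bosonization) B * H, by direct computation in Sweedler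
notation.

The smash product is associative because act is a module algebra action, and
the smash coproduct is coassociative because coact is a comodule coalgebra
coaction ([smash_algebra], [smash_coalgebra]); the conditions of the theorem
only concern the compatibility of the two structures.

From the conditions to the bialgebra: expand both sides of
Delta((a * g)(b * h)) = Delta(a * g) Delta(b * h). On the left, the formula for
delta_B(a(g1.b)), the module coalgebra axiom and the comodule algebra axiom
produce the factor (g2.b2)_(-1) g3 (x) (g2.b2)_(0), which the Yetter-Drinfeld
condition (2) turns into g2 b2_(-1) (x) g3.b2_(0). On the right, the coaction
is made to act twice on a2 by its coassociativity. The two expansions then
agree ([smash_comulM]).

From the bialgebra to the conditions: let p_B = id (x) eps_H and
p_H = eps_B (x) id be the two projections of B (x) H. Multiplicativity of the
counit makes eps_B multiplicative and act-invariant. Applying p_B (x) p_B and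
p_H (x) p_B to Delta((a * g)(b * 1)) = Delta(a * g) Delta(b * 1) gives one
formula for delta_B(a(g.b)) and one for (a(g1.b))_(-1) g2 (x) (a(g1.b))_(0)
([bialg_comulB_mul_act], [bialg_coact_mul_act]). Their specializations to a = 1
and to g = 1 are the module coalgebra axiom, (1), the Yetter-Drinfeld condition
(2) and the comodule algebra axiom.

The antipode: in S(x1) x2 the middle factors are S_B(b1_(0)) b2_(0), and the
comodule coalgebra axiom collects their coactions into that of b, so S_B
cancels first and S_H second. In x1 S(x2), coassociativity of the coaction
brings the factors in H to the form v1 S_H(v2) with v = b2_(-1) h, so S_H
cancels first.

A sum \tsum runs over an arbitrary representative of a tensor. Interchanging
sums and moving linear maps inside them are therefore manipulations of finite
sums; substituting a coalgebra identity into a sum changes the representative,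
which is legitimate when the summand is multilinear, as the tactic [multilinear]
proves each time. *)

(** * Multilinearity of Sweedler sums *)

Section Multilinear.
Variable k : fieldType.
Implicit Types U V W X Y Z : lmodType k.

Definition trilinear X Y Z U (f : X -> Y -> Z -> U) : Prop :=
  [/\ forall y z, linear (fun x => f x y z),
      forall x z, linear (fun y => f x y z) &
      forall x y, linear (fun z => f x y z)].

Lemma bilinearI V W U (f : V -> W -> U) :
  (forall w, linear (fun v => f v w)) -> (forall v, linear (f v)) ->
  is_bilinear f.
Proof. by split. Qed.

Lemma linear_id V : linear (fun v : V => v).
Proof. by []. Qed.

Lemma linear_app V W U (f : W -> U) (u : V -> W) :
  linear f -> linear u -> linear (fun x => f (u x)).
Proof. by move=> fl ul a x y; rewrite ul fl. Qed.

Lemma linear_appl V W X U (f : W -> X -> U) (u : V -> W) c :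
  is_bilinear f -> linear u -> linear (fun x => f (u x) c).
Proof. by move=> [fl _] ul a x y; rewrite ul; exact: fl. Qed.

Lemma linear_scalel V U (s : V -> k) (c : U) :
  linear (s : V -> k^o) -> linear (fun x => s x *: c).
Proof. by move=> sl a x y; rewrite sl scalerDl scalerA. Qed.

Lemma linear_scaler V U (u : V -> U) (c : k) :
  linear u -> linear (fun x => c *: u x).
Proof. by move=> ul a x y; rewrite ul scalerDr !scalerA mulrC. Qed.

Lemma linear_tsum V W X U (t : X -> V \ox W) (f : V -> W -> U) :
  is_bilinear f -> linear t -> linear (fun x => tsum (t x) f).
Proof. by move=> fb tl a x y; rewrite tl (tsum_linear fb). Qed.

End Multilinear.

(** Fails on functions that are not constant. *)
Ltac constant_value f := lazymatch f with fun _ => ?c => constr:(c) end.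

(** Descends along the unique occurrence of the variable. The position of that
occurrence in a two-argument term is found by testing which of the two
arguments is constant; heads whose linearity is known are looked up among the
hypotheses. *)
Ltac multilinear :=
  intros; cbv beta;
  lazymatch goal with
  | |- trilinear _ => split; multilinear
  | |- bilinear_for _ _ (@pure _ _ _) => exact: pure_bilinear
  | |- bilinear_for _ _ (fun x => _) => apply: bilinearI; multilinear
  | |- bilinear_for _ _ _ =>
      first [ assumption | apply: bilinearI; multilinear ]
  | |- GRing.linear_for _ (fun x => x) => exact: linear_id
  | |- GRing.linear_for _ (fun x => tsum (@?t x) (@?F x)) =>
      first [ let t0 := constant_value t in
              refine (@tsum_linear_arg _ _ _ _ _ t0 F _)
            | let F0 := constant_value F in
              refine (@linear_tsum _ _ _ _ _ t F0 _ _) ]; multilinear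
  | |- GRing.linear_for _ (fun x => @?s x *: @?c x) =>
      first [ let c0 := constant_value c in
              refine (@linear_scalel _ _ _ s c0 _)
            | let s0 := constant_value s in
              refine (@linear_scaler _ _ _ c s0 _) ]; multilinear
  | |- GRing.linear_for _ (fun x => ?m (@?v x) (@?u x)) =>
      first [ match goal with H : _ |- _ => solve [apply: H] end
            | let c := constant_value v in
              refine (@linear_app _ _ _ _ (m c) u _ _); [|multilinear];
              multilinear
            | let c := constant_value u in
              refine (@linear_appl _ _ _ _ _ m v c _ _); multilinear ]
  | |- GRing.linear_for _ (fun x => ?f (@?u x)) =>
      first [ match goal with H : _ |- _ => solve [apply: H] end
            | refine (@linear_app _ _ _ _ f u _ _); [|multilinear];
              multilinear ]
  | |- GRing.linear_for _ ?f =>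
      match goal with
      | H : _ |- _ => solve [apply: H | exact: (H.2 _)]
      | |- _ => lazymatch f with
        | pure _ => exact: (pure_bilinear _ _).2
        end
      end
  end.

(** * Rewriting Sweedler sums *)

Section Sweedler.
Variable k : fieldType.
Implicit Types U V W X Y Z : lmodType k.

Lemma linear_map_sum U V (g : U -> V) : linear g ->
  forall I (r : seq I) (F : I -> U),
  g (\sum_(i <- r) F i) = \sum_(i <- r) g (F i).
Proof.
move=> g_lin I r F.
have gD : {morph g : x y / x + y}.
  by move=> x y; have := g_lin 1 x y; rewrite !scale1r.
have g0 : g 0 = 0 by apply: (addIr (g 0)); rewrite -gD addr0 add0r.
exact: (big_morph g gD g0).
Qed.

Lemma linear_mapZ U V (g : U -> V) : linear g ->
  forall a x, g (a *: x) = a *: g x.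
Proof.
move=> g_lin a x; rewrite -[a *: x]addr0 g_lin.
have g0 : g 0 = 0.
  by apply: (addIr (g 0)); have := g_lin 1 0 0; rewrite !scale1r addr0 add0r.
by rewrite g0 addr0.
Qed.

Lemma eq_tsum V W U (t : V \ox W) (f g : V -> W -> U) :
  (forall v w, f v w = g v w) -> tsum t f = tsum t g.
Proof. by move=> fg; apply: eq_bigr => p _. Qed.

Lemma linear_tsumE V W U X (t : V \ox W) (f : V -> W -> U) (g : U -> X) :
  linear g -> g (tsum t f) = \tsum_(v, w <- t) g (f v w).
Proof. by move=> gl; rewrite /tsum linear_map_sum. Qed.

Lemma bilinear_tsuml V W U X Y (m : U -> X -> Y) : is_bilinear m ->
  forall (t : V \ox W) (f : V -> W -> U) x,
  m (tsum t f) x = \tsum_(v, w <- t) m (f v w) x.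
Proof. by move=> mb t f x; rewrite (linear_tsumE t f (mb.1 x)). Qed.

Lemma bilinear_tsumr V W U X Y (m : X -> U -> Y) : is_bilinear m ->
  forall (t : V \ox W) (f : V -> W -> U) x,
  m x (tsum t f) = \tsum_(v, w <- t) m x (f v w).
Proof. by move=> mb t f x; rewrite (linear_tsumE t f (mb.2 x)). Qed.

Lemma tsum_scale V W U (t : V \ox W) c (f : V -> W -> U) :
  \tsum_(v, w <- t) c *: f v w = c *: tsum t f.
Proof. by rewrite /tsum scaler_sumr. Qed.

Lemma tsum_swap V W X Y U (s : V \ox W) (t : X \ox Y)
    (f : V -> W -> X -> Y -> U) :
  \tsum_(v, w <- s) \tsum_(x, y <- t) f v w x y
  = \tsum_(x, y <- t) \tsum_(v, w <- s) f v w x y.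
Proof. exact: exchange_big. Qed.

Lemma tsum_tsum V W X Y U (t : V \ox W) (G : V -> W -> X \ox Y)
    (f : X -> Y -> U) :
  is_bilinear f ->
  tsum (\tsum_(v, w <- t) G v w) f = \tsum_(v, w <- t) tsum (G v w) f.
Proof. by move=> fb; rewrite (linear_tsumE _ _ (tsum_linear fb)). Qed.

Lemma tensor_mul_bilinear V (m : V -> V -> V) : is_bilinear m ->
  is_bilinear (tensor_mul m).
Proof. by move=> m_bil; rewrite /tensor_mul; multilinear. Qed.

(** Coassociativity is an equation in a triple tensor product. Contracting both
sides with a trilinear map is what lets one substitute it in a longer
sum. *)
Definition contract3 X Y Z U (f : X -> Y -> Z -> U) (t : X \ox (Y \ox Z)) : U :=
  \tsum_(x, yz <- t) tsum yz (f x).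

Section Contract3.
Variables (X Y Z U : lmodType k) (f : X -> Y -> Z -> U).
Hypothesis f_tri : trilinear f.

Let f1 : forall y z, linear (fun x => f x y z). Proof. by case: f_tri. Qed.
Let f2 : forall x z, linear (fun y => f x y z). Proof. by case: f_tri. Qed.
Let f3 : forall x y, linear (fun z => f x y z). Proof. by case: f_tri. Qed.

Lemma contract3_linear : linear (contract3 f).
Proof. rewrite /contract3; multilinear. Qed.

Lemma contract3_tsum V W (t : V \ox W) (F : V -> W -> X \ox (Y \ox Z)) :
  contract3 f (tsum t F) = \tsum_(v, w <- t) contract3 f (F v w).
Proof. exact: linear_tsumE contract3_linear. Qed.

Lemma contract3_pure x t : contract3 f (x \ox t) = tsum t (f x).
Proof. by rewrite /contract3 tsum_pure //; multilinear. Qed.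

Lemma contract3_pure3 x y z : contract3 f (x \ox (y \ox z)) = f x y z.
Proof. by rewrite contract3_pure tsum_pure //; multilinear. Qed.

Definition contract3E := (contract3_tsum, contract3_pure3, contract3_pure).
End Contract3.
End Sweedler.

(** Brings the sum over [t] outermost by exchanging sums; the reordered sum is
computed into an existential variable on the right-hand side. *)
Ltac pull_sum t :=
  lazymatch goal with
  | |- tsum t _ = _ => reflexivity
  | |- tsum _ _ = _ =>
      etransitivity; [apply: eq_tsum => ? ?; pull_sum t | exact: tsum_swap]
  end.

(** Peels off equal nested sums whose tensors come in different orders, leaving
the equality of the summands. *)
Ltac match_sums :=
  lazymatch goal with
  | |- tsum ?t _ = _ =>
      etransitivity; [|symmetry; pull_sum t];
      apply: eq_tsum => ? ?; cbv beta; match_sums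
  | |- _ => idtac
  end.

(** * Sweedler identities for coalgebras and comodules *)

Section Coalgebra.
Variables (k : fieldType) (V U : lmodType k).
Variables (comul : V -> V \ox V) (counit : V -> k).
Hypothesis coalgV : is_coalgebra comul counit.

Let comul_lin : linear comul := coalg_comul_linear coalgV.

Lemma sweedler_coassoc (f : V -> V -> V -> U) x : trilinear f ->
  \tsum_(x1, x2 <- comul x) \tsum_(x11, x12 <- comul x1) f x11 x12 x2
  = \tsum_(x1, x2 <- comul x) \tsum_(x21, x22 <- comul x2) f x1 x21 x22.
Proof.
move=> f_tri; have := congr1 (contract3 f) (coalg_coassoc coalgV x).
rewrite !contract3E //.
under eq_tsum => x1 x2.
  rewrite contract3E //; under eq_tsum => x11 x12 do rewrite contract3E //.
  over.
by under [in RHS]eq_tsum => x1 x2 do rewrite contract3E //.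
Qed.

Lemma sweedler_counitl (f : V -> U) x : linear f ->
  \tsum_(x1, x2 <- comul x) counit x1 *: f x2 = f x.
Proof.
move=> fl; rewrite -[in RHS](coalg_counitl coalgV x) (linear_tsumE _ _ fl).
by apply: eq_tsum => x1 x2; rewrite (linear_mapZ fl).
Qed.

Lemma sweedler_counitr (f : V -> U) x : linear f ->
  \tsum_(x1, x2 <- comul x) counit x2 *: f x1 = f x.
Proof.
move=> fl; rewrite -[in RHS](coalg_counitr coalgV x) (linear_tsumE _ _ fl).
by apply: eq_tsum => x1 x2; rewrite (linear_mapZ fl).
Qed.

End Coalgebra.

Section Comodule.
Variables (k : fieldType) (H B U : lmodType k).
Variables (comulH : H -> H \ox H) (counitH : H -> k) (coact : B -> H \ox B).
Hypothesis comodB : is_comodule comulH counitH coact.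

Lemma sweedler_coact_coassoc (f : H -> H -> B -> U) b : trilinear f ->
  \tsum_(b', b0 <- coact b) \tsum_(h1, h2 <- comulH b') f h1 h2 b0
  = \tsum_(b', b0 <- coact b) \tsum_(c', c0 <- coact b0) f b' c' c0.
Proof.
move=> f_tri; have := congr1 (contract3 f) (comod_coassoc comodB b).
rewrite !contract3E //.
under eq_tsum => x1 x2.
  rewrite contract3E //; under eq_tsum => x11 x12 do rewrite contract3E //.
  over.
by under [in RHS]eq_tsum => x1 x2 do rewrite contract3E //.
Qed.

Lemma sweedler_coact_counit (f : B -> U) b : linear f ->
  \tsum_(b', b0 <- coact b) counitH b' *: f b0 = f b.
Proof.
move=> fl; rewrite -[in RHS](comod_counit comodB b) (linear_tsumE _ _ fl).
by apply: eq_tsum => x1 x2; rewrite (linear_mapZ fl).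
Qed.

End Comodule.

Section Smash.
Variables (k : fieldType) (H B : lmodType k).
Variables (mulH : H -> H -> H) (oneH : H).
Variables (comulH : H -> H \ox H) (counitH : H -> k).
Variables (mulB : B -> B -> B) (oneB : B).
Variables (comulB : B -> B \ox B) (counitB : B -> k).
Variables (act : H -> B -> B) (coact : B -> H \ox B).
Hypothesis bialgH : is_bialgebra mulH oneH comulH counitH.
Hypothesis modalgB : is_module_algebra mulH oneH comulH counitH mulB oneB act.
Hypothesis comodcoalgB :
  is_comodule_coalgebra mulH oneH comulH counitH comulB counitB coact.
Implicit Type U : lmodType k.

Local Notation smul := (smash_mul mulH comulH mulB act).
Local Notation sone := (smash_one oneH oneB).
Local Notation scomul := (smash_comul mulH comulH comulB coact).
Local Notation scounit := (smash_counit counitH counitB).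

Let algH := bialg_alg bialgH.
Let coalgH := bialg_coalg bialgH.
Let mulHA := alg_mulA algH.
Let mul1H := alg_1mul algH.
Let mulH1 := alg_mul1 algH.
Let algB := modalg_alg modalgB.
Let mulBA := alg_mulA algB.
Let mul1B := alg_1mul algB.
Let mulB1 := alg_mul1 algB.
Let modB := modalg_mod modalgB.
Let actM := mod_mul modB.
Let act1 := mod_one modB.
Let comodB := comodcoalg_comod comodcoalgB.
Let coalgB := comodcoalg_coalg comodcoalgB.
Let mulH_bil : is_bilinear mulH := alg_bilinear algH.
Let mulB_bil : is_bilinear mulB := alg_bilinear algB.
Let act_bil : is_bilinear act := mod_bilinear modB.
Let comulH_lin : linear comulH := coalg_comul_linear coalgH.
Let comulB_lin : linear comulB := coalg_comul_linear coalgB.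
Let coact_lin : linear coact := comod_linear comodB.
Let counitH_lin : linear (counitH : H -> k^o) := coalg_counit_linear coalgH.
Let counitB_lin : linear (counitB : B -> k^o) := coalg_counit_linear coalgB.

Lemma counitHM g h : counitH (mulH g h) = counitH g * counitH h.
Proof. exact: (algmap_mul (bialg_counit bialgH)). Qed.

Lemma counitH1 : counitH oneH = 1.
Proof. exact: (algmap_one (bialg_counit bialgH)). Qed.

Lemma comulH1 : comulH oneH = oneH \ox oneH.
Proof. exact: (algmap_one (bialg_comul bialgH)). Qed.

Lemma sweedler_comulHM U (f : H -> H -> U) g h : is_bilinear f ->
  \tsum_(u1, u2 <- comulH (mulH g h)) f u1 u2
  = \tsum_(g1, g2 <- comulH g) \tsum_(h1, h2 <- comulH h)
      f (mulH g1 h1) (mulH g2 h2).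
Proof.
move=> fb; rewrite (algmap_mul (bialg_comul bialgH)) /tensor_mul tsum_tsum //.
apply: eq_tsum => g1 g2; rewrite tsum_tsum //.
by apply: eq_tsum => h1 h2; rewrite tsum_pure.
Qed.

Lemma sweedler_coact_comulB U (f : H -> B -> B -> U) b : trilinear f ->
  \tsum_(b', b0 <- coact b) \tsum_(b01, b02 <- comulB b0) f b' b01 b02
  = \tsum_(b1, b2 <- comulB b)
      \tsum_(b1', b10 <- coact b1) \tsum_(b2', b20 <- coact b2)
        f (mulH b1' b2') b10 b20.
Proof.
move=> f_tri; have := congr1 (contract3 f) (comodcoalg_comul comodcoalgB b).
rewrite !contract3E //.
under eq_tsum => x1 x2 do rewrite contract3E //.
move=> ->; apply: eq_tsum => b1 b2; rewrite contract3E //.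
apply: eq_tsum => b1' b10; rewrite contract3E //.
by apply: eq_tsum => b2' b20; rewrite contract3E.
Qed.

Lemma sweedler_coact_counitB U (f : H -> U) b : linear f ->
  \tsum_(b', b0 <- coact b) counitB b0 *: f b' = counitB b *: f oneH.
Proof.
move=> fl; rewrite -(linear_mapZ fl) -(comodcoalg_counit comodcoalgB).
rewrite (linear_tsumE _ _ fl).
by apply: eq_tsum => x1 x2; rewrite (linear_mapZ fl).
Qed.

(** * The smash product algebra *)

Lemma smash_mulE a g b h : smul (a \ox g) (b \ox h)
  = \tsum_(g1, g2 <- comulH g) mulB a (act g1 b) \ox mulH g2 h.
Proof. exact: smash_mul_pure. Qed.

Lemma smash_comulE b h : scomul (b \ox h)
  = \tsum_(b1, b2 <- comulB b) \tsum_(h1, h2 <- comulH h)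
      \tsum_(b2', b20 <- coact b2) (b1 \ox mulH b2' h1) \ox (b20 \ox h2).
Proof. exact: smash_comul_pure. Qed.

Lemma smash_counitE b h : scounit (b \ox h) = counitB b * counitH h.
Proof. exact: smash_counit_pure. Qed.

Lemma smash_mul_bilinear : is_bilinear smul.
Proof. rewrite /smash_mul; multilinear. Qed.

Lemma smash_comul_linear : linear scomul.
Proof. rewrite /smash_comul; multilinear. Qed.

Lemma smash_counit_linear : linear (scounit : B \ox H -> k^o).
Proof.
apply: (@tsum_linear k B H k^o (fun b h => counitB b *: (counitH h : k^o))).
apply: bilinearI => [h|b]; first exact: linear_scalel.
exact: linear_scaler.
Qed.

(** Both sides become a (g1.b) (g2 h1.c) * g3 h2 l: the left one by the module
algebra axiom, the right one by multiplicativity of Delta_H. *)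
Lemma smash_mulA x y z : smul x (smul y z) = smul (smul x y) z.
Proof.
have smul_bil := smash_mul_bilinear.
move: x; apply: tensor_ext => [||a g]; [multilinear|multilinear|].
move: y; apply: tensor_ext => [||b h]; [multilinear|multilinear|].
move: z; apply: tensor_ext => [||c l]; [multilinear|multilinear|].
rewrite !smash_mulE (bilinear_tsumr smul_bil) (bilinear_tsuml smul_bil).
under eq_tsum => h1 h2.
  rewrite smash_mulE.
  under eq_tsum => g1 g2 do
    rewrite (modalg_mul modalgB) (bilinear_tsumr mulB_bil)
      (bilinear_tsuml (pure_bilinear _ _)).
  rewrite (sweedler_coassoc coalgH); last first.
    by multilinear.
  over.
rewrite tsum_swap; apply: eq_tsum => g1 g2.
rewrite smash_mulE sweedler_comulHM; last by multilinear.
rewrite tsum_swap; apply: eq_tsum => h1 h2.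
by apply: eq_tsum => g21 g22; rewrite actM !mulHA !mulBA.
Qed.


Let smul_bil := smash_mul_bilinear.
Let pure_bil (V W : lmodType k) : is_bilinear (@pure k V W) :=
  pure_bilinear V W.

(** Holds because Delta(1) = 1 (x) 1, so that 1 acts trivially on d. *)
Lemma smash_mul_oneH c d h : smul (c \ox oneH) (d \ox h) = mulB c d \ox h.
Proof.
rewrite smash_mulE comulH1 tsum_pure; last by multilinear.
by rewrite act1 mul1H.
Qed.

Lemma smash_mul_oneB a g h : smul (a \ox g) (oneB \ox h) = a \ox mulH g h.
Proof.
rewrite smash_mulE; under eq_tsum => g1 g2 do
  rewrite (modalg_one modalgB) (linear_mapZ (mulB_bil.2 _)) mulB1
    (linear_mapZ ((pure_bil _ _).1 _)).
rewrite (sweedler_counitl coalgH (f := fun x => a \ox mulH x h)) //.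
by multilinear.
Qed.

Lemma smash_algebra : is_algebra smul sone.
Proof.
split=> [||x|x]; [exact: smash_mul_bilinear|exact: smash_mulA| |].
- move: x; apply: tensor_ext => [||b h]; [multilinear|multilinear|].
  by rewrite smash_mul_oneH mul1B.
- move: x; apply: tensor_ext => [||b h]; [multilinear|multilinear|].
  by rewrite smash_mul_oneB mulH1.
Qed.

(** * The smash coproduct coalgebra *)

Lemma sweedler_smash_comul U (f : B \ox H -> B \ox H -> U) b h :
  is_bilinear f ->
  \tsum_(x1, x2 <- scomul (b \ox h)) f x1 x2
  = \tsum_(b1, b2 <- comulB b) \tsum_(h1, h2 <- comulH h)
      \tsum_(b2', b20 <- coact b2) f (b1 \ox mulH b2' h1) (b20 \ox h2).
Proof.
move=> fb; rewrite smash_comulE tsum_tsum //.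
apply: eq_tsum => b1 b2; rewrite tsum_tsum //.
apply: eq_tsum => h1 h2; rewrite tsum_tsum //.
by apply: eq_tsum => b2' b20; rewrite tsum_pure.
Qed.

(** Both sides are reduced to sums over the threefold comultiplications of b and
h. On the left, multiplicativity of Delta_H splits Delta(b3_(-1) h1). On the
right, the comodule coalgebra axiom splits the coaction of b2 along
delta_B(b2_(0)), and coassociativity of the coaction replaces the coaction on
b3_(0) by the comultiplication of b3_(-1). *)
Lemma smash_coassoc x :
  \tsum_(x1, x2 <- scomul x) \tsum_(x11, x12 <- scomul x1) x11 \ox (x12 \ox x2)
  = \tsum_(x1, x2 <- scomul x) x1 \ox scomul x2.
Proof.
have scomul_lin := smash_comul_linear.
move: x; apply: tensor_ext => [||b h]; [multilinear|multilinear|].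
pose G (b1 b21 b22 : B) (h11 h12 h2 : H) :=
  \tsum_(b21', b210 <- coact b21) \tsum_(b22', b220 <- coact b22)
  \tsum_(u1, u2 <- comulH b22')
    (b1 \ox mulH b21' (mulH u1 h11))
      \ox ((b210 \ox mulH u2 h12) \ox (b220 \ox h2)).
transitivity (\tsum_(b1, b2 <- comulB b) \tsum_(b21, b22 <- comulB b2)
  \tsum_(h1, h2 <- comulH h) \tsum_(h11, h12 <- comulH h1)
    G b1 b21 b22 h11 h12 h2).
- rewrite sweedler_smash_comul; last by multilinear.
  transitivity (\tsum_(b1, b2 <- comulB b) \tsum_(b11, b12 <- comulB b1)
    \tsum_(h1, h2 <- comulH h) \tsum_(h11, h12 <- comulH h1)
      G b11 b12 b2 h11 h12 h2); last first.
    by rewrite (sweedler_coassoc coalgB) //; rewrite /G; multilinear.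
  apply: eq_tsum => b1 b2; rewrite [RHS]tsum_swap; apply: eq_tsum => h1 h2.
  under eq_tsum => b2' b20.
    rewrite sweedler_smash_comul; last by multilinear.
    under eq_tsum => b11 b12 do
      (rewrite sweedler_comulHM; last by multilinear).
    over.
  by rewrite /G; match_sums; rewrite !mulHA.
- rewrite sweedler_smash_comul; last by multilinear.
  apply: eq_tsum => b1 b2.
  transitivity (\tsum_(h1, h2 <- comulH h) \tsum_(h21, h22 <- comulH h2)
    \tsum_(b2', b20 <- coact b2) \tsum_(b201, b202 <- comulB b20)
    \tsum_(c', c0 <- coact b202)
      (b1 \ox mulH b2' h1) \ox ((b201 \ox mulH c' h21) \ox (c0 \ox h22))).
    transitivity (\tsum_(b21, b22 <- comulB b2)
      \tsum_(h1, h2 <- comulH h) \tsum_(h21, h22 <- comulH h2)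
        G b1 b21 b22 h1 h21 h22).
      apply: eq_tsum => b21 b22.
      by rewrite (sweedler_coassoc coalgH) //; rewrite /G; multilinear.
    rewrite tsum_swap; apply: eq_tsum => h1 h2.
    rewrite tsum_swap; apply: eq_tsum => h21 h22.
    rewrite sweedler_coact_comulB; last by multilinear.
    apply: eq_tsum => b21 b22; apply: eq_tsum => b21' b210.
    rewrite (sweedler_coact_coassoc comodB); last by multilinear.
    by match_sums; rewrite !mulHA.
  apply: eq_tsum => h1 h2.
  under [RHS]eq_tsum => b2' b20.
    rewrite smash_comulE (bilinear_tsumr (pure_bil _ _)).
    under eq_tsum => b21 b22.
      rewrite (bilinear_tsumr (pure_bil _ _)).
      under eq_tsum => h21 h22 do rewrite (bilinear_tsumr (pure_bil _ _)).
      over.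
    over.
  by match_sums.
Qed.

Lemma smash_coalgebra : is_coalgebra scomul scounit.
Proof.
have scounit_lin := smash_counit_linear.
have scomul_lin := smash_comul_linear.
split=> [||x|x|x];
  [exact: scomul_lin|exact: scounit_lin|exact: smash_coassoc| |].
- move: x; apply: tensor_ext => [||b h]; [multilinear|multilinear|].
  rewrite sweedler_smash_comul; last by multilinear.
  transitivity (\tsum_(b1, b2 <- comulB b) counitB b1 *:
    \tsum_(b2', b20 <- coact b2) counitH b2' *:
    \tsum_(h1, h2 <- comulH h) counitH h1 *: (b20 \ox h2)).
    apply: eq_tsum => b1 b2; rewrite -tsum_scale tsum_swap.
    apply: eq_tsum => b2' b20; rewrite -!tsum_scale.
    apply: eq_tsum => h1 h2.
    by rewrite smash_counitE counitHM -!scalerA.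
  under eq_tsum => b1 b2.
    under eq_tsum => b2' b20 do
      (rewrite (sweedler_counitl coalgH); last by multilinear).
    rewrite (sweedler_coact_counit comodB); last by multilinear.
    over.
  by rewrite (sweedler_counitl coalgB) //; multilinear.
- move: x; apply: tensor_ext => [||b h]; [multilinear|multilinear|].
  rewrite sweedler_smash_comul; last by multilinear.
  transitivity (\tsum_(b1, b2 <- comulB b) \tsum_(h1, h2 <- comulH h)
    counitH h2 *: (counitB b2 *: (b1 \ox h1))).
    apply: eq_tsum => b1 b2; apply: eq_tsum => h1 h2.
    (* The unit is the factor b2_(-1) once eps_B has been applied to b2_(0). *)
    rewrite -[in RHS](mul1H h1).
    rewrite -(sweedler_coact_counitB (f := fun x => b1 \ox mulH x h1));
      last by multilinear.
    rewrite -tsum_scale; apply: eq_tsum => b2' b20.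
    by rewrite smash_counitE mulrC -!scalerA.
  under eq_tsum => b1 b2 do
    (rewrite (sweedler_counitr coalgH); last by multilinear).
  by rewrite (sweedler_counitr coalgB) //; multilinear.
Qed.

(** * The conditions imply the bialgebra axioms *)

(** The balanced fourfold comultiplication rebracketed so that the two middle
factors are the components of a single element, as the Yetter-Drinfeld condition
requires. *)
Lemma sweedler_coassoc4 U (f : H -> H -> H -> H -> U) h :
  (forall z t, is_bilinear (fun x y => f x y z t)) ->
  (forall x y, is_bilinear (fun z t => f x y z t)) ->
  \tsum_(h1, h2 <- comulH h) \tsum_(h11, h12 <- comulH h1)
    \tsum_(h21, h22 <- comulH h2) f h11 h12 h21 h22
  = \tsum_(h1, h2 <- comulH h) \tsum_(p, q <- comulH h2)
    \tsum_(p1, p2 <- comulH p) f h1 p1 p2 q.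
Proof.
move=> f12 f34.
have f1 y z t : linear (fun x => f x y z t) by exact: (f12 z t).1.
have f2 x z t : linear (fun y => f x y z t) by exact: (f12 z t).2.
have f3 x y t : linear (fun z => f x y z t) by exact: (f34 x y).1.
have f4 x y z : linear (fun t => f x y z t) by exact: (f34 x y).2.
rewrite (sweedler_coassoc coalgH); last by multilinear.
apply: eq_tsum => h1 h2.
by rewrite -(sweedler_coassoc coalgH) //; multilinear.
Qed.

Section FromConditions.
Hypothesis conds : biproduct_conditions mulH oneH comulH counitH
  mulB oneB comulB counitB act coact.

Let modcoalgB := bipc_module_coalgebra conds.
Let comodalgB := bipc_comodule_algebra conds.

Lemma counitBM a b : counitB (mulB a b) = counitB a * counitB b.
Proof. exact: (algmap_mul (bipc_counit conds)). Qed.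

Lemma counitB1 : counitB oneB = 1.
Proof. exact: (algmap_one (bipc_counit conds)). Qed.

Lemma sweedler_comul_act U (f : B -> B -> U) h b : is_bilinear f ->
  \tsum_(c1, c2 <- comulB (act h b)) f c1 c2
  = \tsum_(h1, h2 <- comulH h) \tsum_(b1, b2 <- comulB b)
      f (act h1 b1) (act h2 b2).
Proof.
move=> fb; rewrite (modcoalg_comul modcoalgB) tsum_tsum //.
apply: eq_tsum => h1 h2; rewrite tsum_tsum //.
by apply: eq_tsum => b1 b2; rewrite tsum_pure.
Qed.

Lemma sweedler_coactM U (f : H -> B -> U) a b : is_bilinear f ->
  \tsum_(c', c0 <- coact (mulB a b)) f c' c0
  = \tsum_(a', a0 <- coact a) \tsum_(b', b0 <- coact b)
      f (mulH a' b') (mulB a0 b0).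
Proof.
move=> fb; rewrite (comodalg_mul comodalgB) tsum_tsum //.
apply: eq_tsum => a' a0; rewrite tsum_tsum //.
by apply: eq_tsum => b' b0; rewrite tsum_pure.
Qed.

Lemma sweedler_comulBM U (f : B -> B -> U) a b : is_bilinear f ->
  \tsum_(c1, c2 <- comulB (mulB a b)) f c1 c2
  = \tsum_(a1, a2 <- comulB a) \tsum_(a2', a20 <- coact a2)
      \tsum_(b1, b2 <- comulB b) f (mulB a1 (act a2' b1)) (mulB a20 b2).
Proof.
move=> fb; rewrite (bipc_comul_mul conds) tsum_tsum //.
apply: eq_tsum => a1 a2; rewrite tsum_tsum //.
apply: eq_tsum => a2' a20; rewrite tsum_tsum //.
by apply: eq_tsum => b1 b2; rewrite tsum_pure.
Qed.

Lemma sweedler_yetter_drinfeld U (f : H -> B -> U) h b : is_bilinear f ->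
  \tsum_(h1, h2 <- comulH h) \tsum_(c', c0 <- coact (act h1 b))
    f (mulH c' h2) c0
  = \tsum_(h1, h2 <- comulH h) \tsum_(b', b0 <- coact b)
      f (mulH h1 b') (act h2 b0).
Proof.
move=> fb; have := congr1 (fun t => tsum t f) (bipc_yetter_drinfeld conds h b).
rewrite !tsum_tsum // => E; apply: etrans (etrans (esym E) _).
  by apply: eq_tsum => h1 h2; rewrite tsum_tsum //;
    apply: eq_tsum => c' c0; rewrite tsum_pure.
by apply: eq_tsum => h1 h2; rewrite tsum_tsum //;
  apply: eq_tsum => c' c0; rewrite tsum_pure.
Qed.

(** The common value is a sum over the fourfold comultiplication g1, p1, p2, q
of g, where p1 and p2 are the factors exchanged by the Yetter-Drinfeld
condition. *)
Lemma smash_comulM x y :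
  scomul (smul x y) = tensor_mul smul (scomul x) (scomul y).
Proof.
have scomul_lin := smash_comul_linear.
have tmul_bil := tensor_mul_bilinear smul_bil.
move: x; apply: tensor_ext => [||a g]; [multilinear|multilinear|].
move: y; apply: tensor_ext => [||b h]; [multilinear|multilinear|].
pose F (a1 : B) (a20' a2' : H) (a200 b1 : B) (b2' : H) (b20 : B)
    (g1 p1 p2 q h1 h2 : H) :=
  (mulB a1 (act a2' (act g1 b1)) \ox
     mulH (mulH (mulH a20' p1) b2') h1)
  \ox (mulB a200 (act p2 b20) \ox mulH q h2).
transitivity (\tsum_(g1, g2 <- comulH g) \tsum_(p, q <- comulH g2)
  \tsum_(p1, p2 <- comulH p)
  \tsum_(a1, a2 <- comulB a) \tsum_(a2', a20 <- coact a2)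
  \tsum_(a20', a200 <- coact a20)
  \tsum_(b1, b2 <- comulB b) \tsum_(b2', b20 <- coact b2)
  \tsum_(h1, h2 <- comulH h)
     F a1 a20' a2' a200 b1 b2' b20 g1 p1 p2 q h1 h2).
- rewrite smash_mulE (linear_tsumE _ _ scomul_lin).
  transitivity (\tsum_(g1, g2 <- comulH g) \tsum_(g11, g12 <- comulH g1)
    \tsum_(g21, g22 <- comulH g2)
    \tsum_(a1, a2 <- comulB a) \tsum_(a2', a20 <- coact a2)
    \tsum_(a20', a200 <- coact a20)
    \tsum_(b1, b2 <- comulB b) \tsum_(e', e0 <- coact (act g12 b2))
    \tsum_(h1, h2 <- comulH h)
      (mulB a1 (act a2' (act g11 b1)) \ox
        mulH (mulH a20' (mulH e' g21)) h1)
      \ox (mulB a200 e0 \ox mulH g22 h2)).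
    apply: eq_tsum => g1 g2; rewrite smash_comulE.
    rewrite sweedler_comulBM; last by multilinear.
    under eq_tsum => a1 a2.
      under eq_tsum => a2' a20.
        rewrite sweedler_comul_act; last by multilinear.
        under eq_tsum => g11 g12.
          under eq_tsum => b1 b2.
            rewrite sweedler_comulHM; last by multilinear.
            under eq_tsum => g21 g22.
              under eq_tsum => h1 h2 do
                (rewrite sweedler_coactM; last by multilinear).
              over.
            over.
          over.
        over.
      over.
    by match_sums; rewrite !mulHA.
  (* g12 and g21 become the components p1, p2 of one element p. *)
  rewrite sweedler_coassoc4; [|multilinear|multilinear].
  apply: eq_tsum => g1 g2; apply: eq_tsum => p q.
  transitivity (\tsum_(a1, a2 <- comulB a) \tsum_(a2', a20 <- coact a2)
    \tsum_(a20', a200 <- coact a20)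
    \tsum_(b1, b2 <- comulB b)
    \tsum_(p1, p2 <- comulH p) \tsum_(e', e0 <- coact (act p1 b2))
    \tsum_(h1, h2 <- comulH h)
      (mulB a1 (act a2' (act g1 b1)) \ox
        mulH (mulH a20' (mulH e' p2)) h1)
      \ox (mulB a200 e0 \ox mulH q h2)).
    by match_sums.
  under eq_tsum => a1 a2.
    under eq_tsum => a2' a20.
      under eq_tsum => a20' a200.
        under eq_tsum => b1 b2 do
          (rewrite (sweedler_yetter_drinfeld (f := fun x y =>
            \tsum_(h1, h2 <- comulH h) (mulB a1 (act a2' (act g1 b1)) \ox
              mulH (mulH a20' x) h1) \ox (mulB a200 y \ox mulH q h2)));
            last by multilinear).
        over.
      over.
    over.
  by match_sums; rewrite /F !mulHA.
- rewrite /tensor_mul sweedler_smash_comul; last by multilinear.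
  transitivity (\tsum_(a1, a2 <- comulB a) \tsum_(g1, g2 <- comulH g)
    \tsum_(a2', a20 <- coact a2)
    \tsum_(b1, b2 <- comulB b) \tsum_(h1, h2 <- comulH h)
    \tsum_(b2', b20 <- coact b2)
    \tsum_(u1, u2 <- comulH a2') \tsum_(g11, g12 <- comulH g1)
    \tsum_(g21, g22 <- comulH g2)
      (mulB a1 (act (mulH u1 g11) b1) \ox mulH (mulH u2 g12) (mulH b2' h1))
      \ox (mulB a20 (act g21 b20) \ox mulH g22 h2)); last first.
    apply: eq_tsum => a1 a2; apply: eq_tsum => g1 g2.
    apply: eq_tsum => a2' a20.
    rewrite sweedler_smash_comul; last by multilinear.
    apply: eq_tsum => b1 b2; apply: eq_tsum => h1 h2.
    apply: eq_tsum => b2' b20; rewrite !smash_mulE.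
    rewrite sweedler_comulHM; last by multilinear.
    rewrite (bilinear_tsuml (pure_bil _ _)); apply: eq_tsum => u1 u2.
    rewrite (bilinear_tsuml (pure_bil _ _)); apply: eq_tsum => g11 g12.
    by rewrite (bilinear_tsumr (pure_bil _ _)).
  transitivity (\tsum_(a1, a2 <- comulB a) \tsum_(b1, b2 <- comulB b)
    \tsum_(b2', b20 <- coact b2) \tsum_(h1, h2 <- comulH h)
    \tsum_(g1, g2 <- comulH g) \tsum_(p, q <- comulH g2)
    \tsum_(p1, p2 <- comulH p) \tsum_(a2', a20 <- coact a2)
    \tsum_(u1, u2 <- comulH a2')
     F a1 u2 u1 a20 b1 b2' b20 g1 p1 p2 q h1 h2).
    rewrite /F.
    under [RHS]eq_tsum => a1 a2.
      under eq_tsum => b1 b2.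
        under eq_tsum => b2' b20.
          under eq_tsum => h1 h2.
            under eq_tsum => g1 g2.
              under eq_tsum => p q.
                under eq_tsum => p1 p2.
                  rewrite (sweedler_coact_coassoc comodB); last by multilinear.
                  over.
                over.
              over.
            over.
          over.
        over.
      over.
    by match_sums.
  under eq_tsum => a1 a2.
    under eq_tsum => b1 b2.
      under eq_tsum => b2' b20.
        under eq_tsum => h1 h2 do
          (rewrite -sweedler_coassoc4; [|by rewrite /F; multilinear..]).
        over.
      over.
    over.
  by match_sums; rewrite /F actM !mulHA.
Qed.

(** eps_B(a(g1.b)) eps_H(g2 h) collapses to a product of counits because eps_B
is multiplicative and satisfies eps_B(g.b) = eps_H(g) eps_B(b). *)
Lemma smash_counitM x y : scounit (smul x y) = scounit x * scounit y.
Proof.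
have scounit_lin := smash_counit_linear.
move: x; apply: (@tensor_ext _ _ _ k^o) => [||a g].
- exact: (linear_app scounit_lin (smul_bil.1 y)).
- exact: (linear_scalel (scounit y : k^o) scounit_lin).
move: y; apply: (@tensor_ext _ _ _ k^o) => [||b h].
- exact: (linear_app scounit_lin (smul_bil.2 _)).
- exact: (linear_scaler (scounit (a \ox g)) scounit_lin).
rewrite smash_mulE (linear_tsumE _ _ scounit_lin) !smash_counitE.
pose c := counitB a * counitB b * counitH h.
have cl : linear (fun x => c *: (counitH x : k^o)) by exact: linear_scaler.
transitivity (c * counitH g); last by rewrite /c; ring.
rewrite -[RHS](sweedler_counitl coalgH g cl).
apply: eq_tsum => g1 g2; rewrite smash_counitE counitBM counitHM.
by rewrite (modcoalg_counit modcoalgB) /c /GRing.scale /=; ring.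
Qed.

Lemma smash_bialgebra : is_bialgebra smul sone scomul scounit.
Proof.
split; [exact: smash_algebra|exact: smash_coalgebra| |]; split.
- exact: smash_comul_linear.
- exact: smash_comulM.
- rewrite /smash_one smash_comulE (bipc_comul_one conds) comulH1.
  rewrite tsum_pure ?tsum_pure; [|multilinear..].
  rewrite (comodalg_one comodalgB) tsum_pure; last by multilinear.
  by rewrite mul1H.
- exact: smash_counit_linear.
- exact: smash_counitM.
- by rewrite /smash_one smash_counitE counitB1 counitH1 mulr1.
Qed.

(** * The antipode *)

Section Antipode.
Variables (SB : B -> B) (SH : H -> H).
Hypothesis SB_antipode : is_antipode mulB oneB comulB counitB SB.
Hypothesis SH_antipode : is_antipode mulH oneH comulH counitH SH.

Let SB_lin : linear SB := antipode_linear SB_antipode.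
Let SH_lin : linear SH := antipode_linear SH_antipode.

Definition smash_antipode (x : B \ox H) : B \ox H :=
  \tsum_(b, h <- x) \tsum_(b', b0 <- coact b)
    smul (oneB \ox SH (mulH b' h)) (SB b0 \ox oneH).

Lemma smash_antipode_linear : linear smash_antipode.
Proof. rewrite /smash_antipode; multilinear. Qed.

Lemma smash_antipodeE b h : smash_antipode (b \ox h)
  = \tsum_(b', b0 <- coact b) smul (oneB \ox SH (mulH b' h)) (SB b0 \ox oneH).
Proof. by rewrite /smash_antipode tsum_pure //; multilinear. Qed.

Lemma smash_antipode_expanded b h : smash_antipode (b \ox h)
  = \tsum_(b', b0 <- coact b) \tsum_(u1, u2 <- comulH (SH (mulH b' h)))
      act u1 (SB b0) \ox u2.
Proof.
rewrite smash_antipodeE; apply: eq_tsum => b' b0; rewrite smash_mulE.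
by apply: eq_tsum => u1 u2; rewrite mul1B mulH1.
Qed.

(** The comodule coalgebra axiom gathers the coactions of b1 and b2 into
b_(-1), which makes S_B(b_(0)1) b_(0)2 cancel; then eps_B(b_(0)) kills b_(-1)
and S_H(h1) h2 cancels. *)
Lemma smash_antipodel x :
  \tsum_(x1, x2 <- scomul x) smul (smash_antipode x1) x2 = scounit x *: sone.
Proof.
have scounit_lin := smash_counit_linear.
have scomul_lin := smash_comul_linear.
have S_lin := smash_antipode_linear.
move: x; apply: tensor_ext => [||b h]; [multilinear|multilinear|].
rewrite sweedler_smash_comul; last by multilinear.
transitivity (\tsum_(h1, h2 <- comulH h)
  \tsum_(b', b0 <- coact b) \tsum_(b01, b02 <- comulB b0)
    smul (oneB \ox SH (mulH b' h1)) (mulB (SB b01) b02 \ox h2)).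
  (* S(x1) x2 = (1 * S_H(..))((S_B(b1_(0)) * 1)(b2_(0) * h2)), rebracketed *)
  rewrite tsum_swap; apply: eq_tsum => h1 h2.
  rewrite sweedler_coact_comulB; last by multilinear.
  apply: eq_tsum => b1 b2; rewrite [RHS]tsum_swap; apply: eq_tsum => b2' b20.
  rewrite smash_antipodeE (bilinear_tsuml smul_bil).
  apply: eq_tsum => b1' b10.
  by rewrite -smash_mulA smash_mul_oneH mulHA.
transitivity (\tsum_(h1, h2 <- comulH h)
  counitB b *: (oneB \ox mulH (SH h1) h2)).
  apply: eq_tsum => h1 h2.
  transitivity (\tsum_(b', b0 <- coact b) counitB b0 *:
    (oneB \ox mulH (SH (mulH b' h1)) h2)); last first.
    rewrite (sweedler_coact_counitB
      (f := fun x => oneB \ox mulH (SH (mulH x h1)) h2)) ?mul1H //.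
    by multilinear.
  apply: eq_tsum => b' b0.
  rewrite -(bilinear_tsumr smul_bil) -(bilinear_tsuml (pure_bil _ _)).
  rewrite (antipodel SB_antipode) (linear_mapZ ((pure_bil _ _).1 _)).
  by rewrite (linear_mapZ (smul_bil.2 _)) smash_mul_oneB.
rewrite tsum_scale -(bilinear_tsumr (pure_bil _ _)) (antipodel SH_antipode).
by rewrite (linear_mapZ ((pure_bil _ _).2 _)) scalerA smash_counitE.
Qed.

(** Coassociativity of the coaction and multiplicativity of Delta_H give
b1 * v1 S_H(v2) with v = b2_(-1) h; once S_H has cancelled, only b1 S_B(b2)
is left. *)
Lemma smash_antipoder x :
  \tsum_(x1, x2 <- scomul x) smul x1 (smash_antipode x2) = scounit x *: sone.
Proof.
have scounit_lin := smash_counit_linear.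
have scomul_lin := smash_comul_linear.
have S_lin := smash_antipode_linear.
move: x; apply: tensor_ext => [||b h]; [multilinear|multilinear|].
rewrite sweedler_smash_comul; last by multilinear.
transitivity (\tsum_(b1, b2 <- comulB b) \tsum_(b2', b20 <- coact b2)
  \tsum_(v1, v2 <- comulH (mulH b2' h))
    smul (b1 \ox mulH v1 (SH v2)) (SB b20 \ox oneH)).
  apply: eq_tsum => b1 b2.
  transitivity (\tsum_(h1, h2 <- comulH h) \tsum_(b2', b20 <- coact b2)
    \tsum_(c', c0 <- coact b20)
      smul (b1 \ox mulH (mulH b2' h1) (SH (mulH c' h2))) (SB c0 \ox oneH)).
    apply: eq_tsum => h1 h2; apply: eq_tsum => b2' b20.
    rewrite smash_antipodeE (bilinear_tsumr smul_bil).
    by apply: eq_tsum => c' c0; rewrite smash_mulA smash_mul_oneB.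
  under eq_tsum => h1 h2 do
    (rewrite -(sweedler_coact_coassoc comodB (f := fun x y z =>
      smul (b1 \ox mulH (mulH x h1) (SH (mulH y h2))) (SB z \ox oneH)));
      last by multilinear).
  rewrite tsum_swap; apply: eq_tsum => b2' b20.
  by rewrite sweedler_comulHM; [match_sums|multilinear].
transitivity (\tsum_(b1, b2 <- comulB b)
  counitH h *: (mulB b1 (SB b2) \ox oneH)).
  apply: eq_tsum => b1 b2.
  transitivity (\tsum_(b2', b20 <- coact b2)
    counitH b2' *: (counitH h *: (mulB b1 (SB b20) \ox oneH))).
    apply: eq_tsum => b2' b20.
    rewrite -(bilinear_tsuml smul_bil) -(bilinear_tsumr (pure_bil _ _)).
    rewrite (antipoder SH_antipode) counitHM (linear_mapZ ((pure_bil _ _).2 _)).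
    by rewrite (linear_mapZ (smul_bil.1 _)) smash_mul_oneH scalerA.
  by rewrite (sweedler_coact_counit comodB) //; multilinear.
rewrite tsum_scale -(bilinear_tsuml (pure_bil _ _)) (antipoder SB_antipode).
by rewrite (linear_mapZ ((pure_bil _ _).1 _)) scalerA mulrC smash_counitE.
Qed.

Lemma smash_hopf : is_hopf_algebra smul sone scomul scounit smash_antipode.
Proof.
split; first exact: smash_bialgebra.
split; first exact: smash_antipode_linear.
  exact: smash_antipodel.
exact: smash_antipoder.
Qed.

End Antipode.

End FromConditions.

(** * The bialgebra axioms imply the conditions *)

Definition smash_projB (x : B \ox H) : B := \tsum_(b, h <- x) counitH h *: b.
Definition smash_projH (x : B \ox H) : H := \tsum_(b, h <- x) counitB b *: h.

Lemma smash_projB_linear : linear smash_projB.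
Proof. rewrite /smash_projB; multilinear. Qed.

Lemma smash_projH_linear : linear smash_projH.
Proof. rewrite /smash_projH; multilinear. Qed.

Lemma smash_projBE b h : smash_projB (b \ox h) = counitH h *: b.
Proof. by rewrite /smash_projB tsum_pure //; multilinear. Qed.

Lemma smash_projHE b h : smash_projH (b \ox h) = counitB b *: h.
Proof. by rewrite /smash_projH tsum_pure //; multilinear. Qed.

(** The counit of H turns the factor g2 h into scalars. *)
Lemma smash_projB_mul a g b h :
  smash_projB (smul (a \ox g) (b \ox h)) = counitH h *: mulB a (act g b).
Proof.
rewrite smash_mulE (linear_tsumE _ _ smash_projB_linear).
rewrite -(sweedler_counitr coalgH (f := fun x => mulB a (act x b))); last first.
  by multilinear.
rewrite -tsum_scale; apply: eq_tsum => g1 g2.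
by rewrite smash_projBE counitHM mulrC scalerA.
Qed.

Lemma smash_projBB_comul b h :
  \tsum_(x1, x2 <- scomul (b \ox h)) smash_projB x1 \ox smash_projB x2
  = counitH h *: comulB b.
Proof.
have pB_lin := smash_projB_linear.
rewrite sweedler_smash_comul; last by multilinear.
rewrite [in RHS](tensorE (comulB b)) -tsum_scale; apply: eq_tsum => b1 b2.
transitivity (\tsum_(h1, h2 <- comulH h) counitH h1 *: (counitH h2 *:
  \tsum_(b2', b20 <- coact b2) counitH b2' *: (b1 \ox b20))).
  apply: eq_tsum => h1 h2; rewrite -!tsum_scale; apply: eq_tsum => b2' b20.
  rewrite !smash_projBE counitHM (linear_mapZ ((pure_bil _ _).1 _)).
  by rewrite (linear_mapZ ((pure_bil _ _).2 _)) !scalerA; congr (_ *: _); ring.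
under eq_tsum => h1 h2 do
  (rewrite (sweedler_coact_counit comodB); last by multilinear).
rewrite (sweedler_counitl coalgH (f := fun x => counitH x *: (b1 \ox b2))) //.
by multilinear.
Qed.

Lemma smash_projHB_comul b h :
  \tsum_(x1, x2 <- scomul (b \ox h)) smash_projH x1 \ox smash_projB x2
  = \tsum_(b', b0 <- coact b) mulH b' h \ox b0.
Proof.
have pB_lin := smash_projB_linear.
have pH_lin := smash_projH_linear.
rewrite sweedler_smash_comul; last by multilinear.
rewrite -(sweedler_counitl coalgB (f := fun x =>
  \tsum_(b', b0 <- coact x) mulH b' h \ox b0)); last by multilinear.
apply: eq_tsum => b1 b2.
rewrite -tsum_scale tsum_swap; apply: eq_tsum => b2' b20.
transitivity (\tsum_(h1, h2 <- comulH h) counitH h2 *: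
  (counitB b1 *: (mulH b2' h1 \ox b20))).
  apply: eq_tsum => h1 h2; rewrite smash_projBE smash_projHE.
  rewrite (linear_mapZ ((pure_bil _ _).1 _)) (linear_mapZ ((pure_bil _ _).2 _)).
  by rewrite !scalerA mulrC.
by rewrite (sweedler_counitr coalgH (f := fun x =>
  counitB b1 *: (mulH b2' x \ox b20))) //; multilinear.
Qed.

Section FromBialgebra.
Hypothesis bialgS : is_bialgebra smul sone scomul scounit.

Lemma bialg_counitB1 : counitB oneB = 1.
Proof.
have := algmap_one (bialg_counit bialgS).
by rewrite smash_counitE counitH1 mulr1.
Qed.

(** This is multiplicativity of the counit on (a * g)(b * 1). *)
Lemma bialg_counitB_mul_act a g b :
  counitB (mulB a (act g b)) = counitB a * counitH g * counitB b.
Proof.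
have := algmap_mul (bialg_counit bialgS) (a \ox g) (b \ox oneH).
rewrite !smash_counitE counitH1 mulr1 => <-.
rewrite smash_mulE (linear_tsumE _ _ smash_counit_linear).
have fl : linear (fun x => counitB (mulB a (act x b)) : k^o).
  by apply: (linear_app counitB_lin); multilinear.
rewrite -[LHS](sweedler_counitr coalgH g fl).
apply: (@eq_tsum _ _ _ k^o) => g1 g2.
by rewrite smash_counitE mulH1 mulrC.
Qed.

Lemma bialg_counitBM a b : counitB (mulB a b) = counitB a * counitB b.
Proof.
by have := bialg_counitB_mul_act a oneH b; rewrite act1 counitH1 mulr1.
Qed.

Lemma bialg_counitB_act g b : counitB (act g b) = counitH g * counitB b.
Proof.
by have := bialg_counitB_mul_act oneB g b; rewrite mul1B bialg_counitB1 mul1r.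
Qed.

Lemma smash_projH_mul a g b h :
  smash_projH (smul (a \ox g) (b \ox h))
  = (counitB a * counitB b) *: mulH g h.
Proof.
rewrite smash_mulE (linear_tsumE _ _ smash_projH_linear).
rewrite -(sweedler_counitl coalgH (f := fun x => mulH x h)); last first.
  by multilinear.
rewrite -tsum_scale; apply: eq_tsum => g1 g2.
by rewrite smash_projHE bialg_counitB_mul_act scalerA mulrAC.
Qed.

Lemma bialg_comulB1 : comulB oneB = oneB \ox oneB.
Proof.
have := smash_projBB_comul oneB oneH; rewrite counitH1 scale1r => <-.
have pB_lin := smash_projB_linear.
have /= -> := algmap_one (bialg_comul bialgS).
rewrite tsum_pure; last by multilinear.
by rewrite smash_projBE counitH1 scale1r.
Qed.

Lemma bialg_coact1 : coact oneB = oneH \ox oneB.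
Proof.
have pB_lin := smash_projB_linear.
have pH_lin := smash_projH_linear.
transitivity (\tsum_(b', b0 <- coact oneB) mulH b' oneH \ox b0).
  by rewrite [LHS]tensorE; apply: eq_tsum => b' b0; rewrite mulH1.
rewrite -smash_projHB_comul.
have /= -> := algmap_one (bialg_comul bialgS).
rewrite tsum_pure; last by multilinear.
by rewrite smash_projBE smash_projHE counitH1 bialg_counitB1 !scale1r.
Qed.

(** Multiplicativity of the comultiplication on (a * g)(b * 1), in the form in
which the two projections are applied to it. *)
Lemma bialg_sweedler_comulM U (f : B \ox H -> B \ox H -> U) a g b :
  is_bilinear f ->
  \tsum_(g1, g2 <- comulH g)
    \tsum_(x1, x2 <- scomul (mulB a (act g1 b) \ox g2)) f x1 x2
  = \tsum_(a1, a2 <- comulB a) \tsum_(g1, g2 <- comulH g)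
    \tsum_(a2', a20 <- coact a2)
    \tsum_(b1, b2 <- comulB b) \tsum_(b2', b20 <- coact b2)
      f (smul (a1 \ox mulH a2' g1) (b1 \ox b2'))
        (smul (a20 \ox g2) (b20 \ox oneH)).
Proof.
move=> fb; have scomul_lin := smash_comul_linear.
have := congr1 (fun t => tsum t f)
  (algmap_mul (bialg_comul bialgS) (a \ox g) (b \ox oneH)).
rewrite smash_mulE (linear_tsumE _ _ scomul_lin) tsum_tsum // => E.
transitivity (\tsum_(g1, g2 <- comulH g)
    \tsum_(x1, x2 <- scomul (mulB a (act g1 b) \ox mulH g2 oneH)) f x1 x2).
  by apply: eq_tsum => g1 g2; rewrite mulH1.
rewrite {}E /tensor_mul tsum_tsum //.
rewrite sweedler_smash_comul; last by multilinear.
apply: eq_tsum => a1 a2; apply: eq_tsum => g1 g2; apply: eq_tsum => a2' a20.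
rewrite tsum_tsum // sweedler_smash_comul; last by multilinear.
apply: eq_tsum => b1 b2; rewrite comulH1 tsum_pure; last by multilinear.
by apply: eq_tsum => b2' b20; rewrite tsum_pure // mulH1.
Qed.

(** Comes from applying id (x) eps_H to both tensor factors: eps_H kills the
coaction of b2. *)
Lemma bialg_comulB_mul_act a g b :
  comulB (mulB a (act g b))
  = \tsum_(a1, a2 <- comulB a) \tsum_(g1, g2 <- comulH g)
    \tsum_(a2', a20 <- coact a2) \tsum_(b1, b2 <- comulB b)
      mulB a1 (act (mulH a2' g1) b1) \ox mulB a20 (act g2 b2).
Proof.
have pB_lin := smash_projB_linear.
have fb : is_bilinear (fun x y => smash_projB x \ox smash_projB y).
  by multilinear.
have := bialg_sweedler_comulM a g b fb.
under eq_tsum => g1 g2 do rewrite smash_projBB_comul.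
rewrite (sweedler_counitr coalgH (f := fun x => comulB (mulB a (act x b))));
  last by multilinear.
move=> ->; apply: eq_tsum => a1 a2; apply: eq_tsum => g1 g2.
apply: eq_tsum => a2' a20; apply: eq_tsum => b1 b2.
rewrite -(sweedler_coact_counit comodB (f := fun x =>
  mulB a1 (act (mulH a2' g1) b1) \ox mulB a20 (act g2 x))); last by multilinear.
apply: eq_tsum => b2' b20; rewrite !smash_projB_mul counitH1 scale1r.
by rewrite (linear_mapZ ((pure_bil _ _).1 _)).
Qed.

(** Comes from applying eps_B (x) id to the first factor and id (x) eps_H to the
second: the counit of B collapses both comultiplications of B. *)
Lemma bialg_coact_mul_act a g b :
  \tsum_(g1, g2 <- comulH g) \tsum_(c', c0 <- coact (mulB a (act g1 b)))
    mulH c' g2 \ox c0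
  = \tsum_(g1, g2 <- comulH g) \tsum_(a', a0 <- coact a)
    \tsum_(b', b0 <- coact b) mulH (mulH a' g1) b' \ox mulB a0 (act g2 b0).
Proof.
have pB_lin := smash_projB_linear.
have pH_lin := smash_projH_linear.
have fb : is_bilinear (fun x y => smash_projH x \ox smash_projB y).
  by multilinear.
have := bialg_sweedler_comulM a g b fb.
under eq_tsum => g1 g2 do rewrite smash_projHB_comul.
move=> ->; rewrite tsum_swap; apply: eq_tsum => g1 g2.
rewrite -(sweedler_counitl coalgB (f := fun x => \tsum_(a', a0 <- coact x)
    \tsum_(b', b0 <- coact b) mulH (mulH a' g1) b' \ox mulB a0 (act g2 b0)));
  last by multilinear.
apply: eq_tsum => a1 a2; rewrite -tsum_scale; apply: eq_tsum => a2' a20.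
rewrite -(sweedler_counitl coalgB (f := fun x =>
    \tsum_(b', b0 <- coact x) mulH (mulH a2' g1) b' \ox mulB a20 (act g2 b0)));
  last by multilinear.
rewrite -tsum_scale; apply: eq_tsum => b1 b2.
rewrite -!tsum_scale; apply: eq_tsum => b2' b20.
rewrite smash_projB_mul smash_projH_mul counitH1 scale1r.
by rewrite (linear_mapZ ((pure_bil _ _).1 _)) scalerA.
Qed.

Lemma bialg_biproduct_conditions :
  biproduct_conditions mulH oneH comulH counitH
    mulB oneB comulB counitB act coact.
Proof.
split.
- split=> // [h b|]; last exact: bialg_counitB_act.
  rewrite -[act h b in LHS]mul1B bialg_comulB_mul_act bialg_comulB1.
  rewrite tsum_pure; last by multilinear.
  apply: eq_tsum => h1 h2; rewrite bialg_coact1 tsum_pure; last by multilinear.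
  by apply: eq_tsum => b1 b2; rewrite !mul1B mul1H.
- split=> // [a b|]; last exact: bialg_coact1.
  have := bialg_coact_mul_act a oneH b.
  rewrite comulH1 !tsum_pure; [|multilinear..].
  rewrite act1 [X in X = _ -> _](_ : _ = coact (mulB a b)) => [->|].
    apply: eq_tsum => a' a0; apply: eq_tsum => b' b0.
    by rewrite act1 mulH1.
  by rewrite [RHS]tensorE; apply: eq_tsum => c' c0; rewrite mulH1.
- split; [exact: counitB_lin|exact: bialg_counitBM|exact: bialg_counitB1].
- exact: bialg_comulB1.
- move=> a b; rewrite -[b in LHS]act1 bialg_comulB_mul_act.
  apply: eq_tsum => a1 a2; rewrite comulH1 tsum_pure; last by multilinear.
  apply: eq_tsum => a2' a20; apply: eq_tsum => b1 b2.
  by rewrite act1 mulH1.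
- move=> h b; have := bialg_coact_mul_act oneB h b.
  under eq_tsum => h1 h2 do rewrite mul1B.
  move=> ->; apply: eq_tsum => h1 h2.
  rewrite bialg_coact1 tsum_pure; last by multilinear.
  by apply: eq_tsum => b' b0; rewrite mul1H mul1B.
Qed.

End FromBialgebra.

End Smash.

Theorem theorem1p1 (k : fieldType) (H B : lmodType k)
  (mulH : H -> H -> H) (oneH : H) (comulH : H -> H \ox H) (counitH : H -> k)
  (mulB : B -> B -> B) (oneB : B) (comulB : B -> B \ox B) (counitB : B -> k)
  (act : H -> B -> B) (coact : B -> H \ox B)
  (bialgH : is_bialgebra mulH oneH comulH counitH)
  (modalgB : is_module_algebra mulH oneH comulH counitH mulB oneB act)
  (comodcoalgB :
     is_comodule_coalgebra mulH oneH comulH counitH comulB counitB coact) :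
  let smul := smash_mul mulH comulH mulB act in
  let sone := smash_one oneH oneB in
  let scomul := smash_comul mulH comulH comulB coact in
  let scounit := smash_counit counitH counitB in
  let conditions := biproduct_conditions mulH oneH comulH counitH
                      mulB oneB comulB counitB act coact in
  (is_bialgebra smul sone scomul scounit <-> conditions) /\
  (conditions ->
   forall (SB : B -> B) (SH : H -> H),
   is_antipode mulB oneB comulB counitB SB ->
   is_hopf_algebra mulH oneH comulH counitH SH ->
   exists S : B \ox H -> B \ox H,
   [/\ is_hopf_algebra smul sone scomul scounit S,
       forall b h, S (b \ox h) =
         \tsum_(b', b0 <- coact b)
           smul (oneB \ox SH (mulH b' h)) (SB b0 \ox oneH) &
       forall b h, S (b \ox h) =
         \tsum_(b', b0 <- coact b) \tsum_(u1, u2 <- comulH (SH (mulH b' h)))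
           act u1 (SB b0) \ox u2]).
Proof.
move=> smul sone scomul scounit conditions; split.
  split=> [bialgS|conds]; first exact: bialg_biproduct_conditions bialgS.
  exact: smash_bialgebra conds.
move=> conds SB SH antB [_ antH].
exists (smash_antipode mulH oneH comulH mulB oneB act coact SB SH); split.
- exact: smash_hopf.
- by move=> b h; exact: (smash_antipodeE bialgH modalgB comodcoalgB antB antH).
- move=> b h.
  exact: (smash_antipode_expanded bialgH modalgB comodcoalgB antB antH).
Qed.
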